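(* Let $n\ge5$ and let $A\in\mathbb{R}^{n\times n}$ be the clamped-clamped matrix defined in the context. For $p\in\{1,2,\infty\}$, $$\|A^{-1}\|_p\le \frac{(n+1)^4}{32}.$$
   Context: The clamped-clamped matrix $A=[a_{i,j}]_{i,j=1}^n$ is the symmetric pentadiagonal matrix whose nonzero entries are: $a_{1,1}=a_{n,n}=7$; $a_{i,i}=6$ for $2\le i\le n-1$; $a_{i,i+1}=a_{i+1,i}=-4$ for $1\le i\le n-1$; $a_{i,i+2}=a_{i+2,i}=1$ for $1\le i\le n-2$. All other entries are $0$. The matrix $A$ is symmetric positive definite, hence nonsingular. $\|\cdot\|_p$ denotes the matrix norm induced by the vector $p$-norm. *)

(* Defs.v *)
From HB Require Import structures.
From mathcomp Require Import all_boot all_order all_algebra.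
From mathcomp Require Import ring lra zify.
From mathcomp Require Import all_classical all_reals all_analysis.

Set Implicit Arguments.
Unset Strict Implicit.
Unset Printing Implicit Defensive.

Import Order.TTheory GRing.Theory Num.Theory.
Import numFieldNormedType.Exports.

Local Open Scope classical_set_scope.
Local Open Scope ring_scope.

(* Indices are 0-based: the corner entries are (0, 0) and (n.-1, n.-1). *)
Definition clamped_mx (R : realType) (n : nat) : 'M[R]_n :=
  \matrix_(i, j)
    if i == j then if (i == 0%N :> nat) || (i == n.-1 :> nat) then 7 else 6
    else if (i.+1 == j :> nat) || (j.+1 == i :> nat) then - 4
    else if (i.+2 == j :> nat) || (j.+2 == i :> nat) then 1
    else 0.

(* The case -oo is a dummy value. *)
Definition vec_pnorm (R : realType) (n : nat) (p : \bar R) (x : 'cV[R]_n) : R :=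
  match p with
  | r%:E => (\sum_(i < n) `|x i 0| `^ r) `^ r^-1
  | +oo%E => \big[Num.max/0]_(i < n) `|x i 0|
  | -oo%E => 0
  end.

(* The supremum is taken in the extended reals, so that a real upper bound on
   it really bounds every quotient (the supremum in R is 0 on unbounded sets). *)
Definition mx_pnorm (R : realType) (n : nat) (p : \bar R) (M : 'M[R]_n) : \bar R :=
  ereal_sup [set (vec_pnorm p (M *m x) / vec_pnorm p x)%:E
            | x in [set x : 'cV[R]_n | x != 0]].

(* [invmx] returns its argument on singular matrices; the following facts show
   that [invmx (clamped_mx R n)] is the genuine inverse. *)
Definition shift_mx (R : realType) (n : nat) : 'M[R]_n :=
  \matrix_(i, j) (i.+1 == j :> nat)%:R.

Definition second_diff_mx (R : realType) (n : nat) : 'M[R]_n :=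
  2%:M - shift_mx R n - (shift_mx R n)^T.

Lemma mul_shift_mx (R : realType) n m (M : 'M[R]_(n, m)) (i : 'I_n) j
  (h : (i.+1 < n)%N) : (shift_mx R n *m M) i j = M (Ordinal h) j.
Proof.
rewrite mxE (bigD1 (Ordinal h)) //= mxE eqxx mul1r big1 ?addr0 // => k nk.
rewrite mxE; case: eqP => [e|]; last by rewrite mul0r.
by case/eqP: nk; apply: val_inj.
Qed.

Lemma mul_shift_mx0 (R : realType) n m (M : 'M[R]_(n, m)) (i : 'I_n) j :
  (n <= i.+1)%N -> (shift_mx R n *m M) i j = 0.
Proof.
move=> h; rewrite mxE big1 // => k _; rewrite mxE.
by case: eqP => [e|]; rewrite ?mul0r //; have := ltn_ord k; lia.
Qed.

Lemma shift_mx_sqr (R : realType) n i j :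
  (shift_mx R n *m shift_mx R n) i j = (i.+2 == j :> nat)%:R.
Proof.
case: (ltnP i.+1 n) => h; first by rewrite (mul_shift_mx _ _ h) mxE.
by rewrite mul_shift_mx0 //; case: eqP => // e; have := ltn_ord j; lia.
Qed.

Lemma shift_mx_mul_tr (R : realType) n i j :
  (shift_mx R n *m (shift_mx R n)^T) i j
  = ((i == j :> nat) && (i != n.-1 :> nat))%:R.
Proof.
have li := ltn_ord i; have lj := ltn_ord j.
case: (ltnP i.+1 n) => h.
  by rewrite (mul_shift_mx _ _ h) !mxE /=; congr (_%:R); congr nat_of_bool; lia.
by rewrite mul_shift_mx0 //; case: andP => // -[/eqP ? /eqP ?]; lia.
Qed.

Lemma shift_mx_tr_mul (R : realType) n i j :
  ((shift_mx R n)^T *m shift_mx R n) i j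
  = ((i == j :> nat) && (i != 0%N :> nat))%:R.
Proof.
have li := ltn_ord i; have lj := ltn_ord j.
rewrite mxE; case: (posnP i) => h.
  rewrite big1 => [|k _]; first by rewrite andbF.
  by rewrite !mxE h /= mul0r.
have h' : (i.-1 < n)%N by lia.
rewrite (bigD1 (Ordinal h')) //= !mxE /= prednK // eqxx mul1r big1 ?addr0.
  by congr (_%:R); congr nat_of_bool; lia.
move=> k nk; rewrite !mxE; case: eqP => [e|]; last by rewrite mul0r.
by case/eqP: nk; apply: val_inj => /=; rewrite -e.
Qed.

Lemma clamped_mxE (R : realType) n : (1 < n)%N ->
  clamped_mx R n = second_diff_mx R n *m second_diff_mx R n
    + diag_mx (\row_i (2 * ((i == 0%N :> nat)%:R + (i == n.-1 :> nat)%:R))).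
Proof.
move=> n_gt1; set T := second_diff_mx R n; set S := shift_mx R n.
have -> : T *m T = 4%:M - 4 *: S - 4 *: S^T + S *m S + (S *m S)^T
                    + S *m S^T + S^T *m S.
  rewrite /T /second_diff_mx -/S.
  rewrite !(mulmxBl, mulmxBr) !mul_scalar_mx !mul_mx_scalar trmx_mul.
  move: S S^T (S *m S) (S *m S^T) (S^T *m S) (S^T *m S^T) => M1 M2 M3 M4 M5 M6.
  apply/matrixP => i j; rewrite !mxE; case: (i == j); rewrite ?mulr1n ?mulr0n.
    by ring.
  by ring.
apply/matrixP => i j.
have := shift_mx_sqr R i j; have := shift_mx_sqr R j i.
have := shift_mx_mul_tr R i j; have := shift_mx_tr_mul R i j.
rewrite -/S; move: (S *m S) (S *m S^T) (S^T *m S) => M1 M2 M3 e3 e2 e1' e1.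
rewrite !mxE e3 e2 e1 e1' -!val_eqE /=.
have li := ltn_ord i; have lj := ltn_ord j.
move: (nat_of_ord i) (nat_of_ord j) li lj => a b la lb.
case: (eqVneq a b) => [<-|ab].
  have -> : (a.+1 == a) = false by lia.
  have -> : (a.+2 == a) = false by lia.
  have : ~~ ((a == 0%N) && (a == n.-1)) by lia.
  by case: (a == 0%N); case: (a == n.-1) => //= _; ring.
case: (eqVneq a.+1 b) => [<-|ab1] /=.
  have -> : (a.+2 == a) = false by lia.
  have -> : (a.+2 == a.+1) = false by lia.
  have -> : (a.+3 == a) = false by lia.
  by rewrite /=; ring.
case: (eqVneq b.+1 a) => [<-|ba1] /=.
  have -> : (b.+2 == b.+1) = false by lia.
  have -> : (b.+3 == b) = false by lia.
  by rewrite /=; ring.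
have : ~~ ((a.+2 == b) && (b.+2 == a)) by lia.
by case: (a.+2 == b); case: (b.+2 == a) => //= _; ring.
Qed.

Lemma clamped_mx_posdef (R : realType) n (x : 'rV[R]_n) : (1 < n)%N ->
  x != 0 -> 0 < (x *m clamped_mx R n *m x^T) 0 0.
Proof.
move=> n_gt1; apply: contraNT; rewrite -leNgt clamped_mxE //.
set T := second_diff_mx R n.
have TT : T^T = T.
  by rewrite /T /second_diff_mx !raddfB /= tr_scalar_mx trmxK addrAC.
have -> : x *m (T *m T + diag_mx (\row_i (2 * ((i == 0%N :> nat)%:R
    + (i == n.-1 :> nat)%:R)))) *m x^T = (x *m T) *m (x *m T)^T
    + (x *m diag_mx (\row_i (2 * ((i == 0%N :> nat)%:R
    + (i == n.-1 :> nat)%:R)))) *m x^T.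
  by rewrite mulmxDr mulmxDl trmx_mul TT !mulmxA.
rewrite !mxE => qle0.
have n_gt0 : (0 < n)%N by lia.
set s1 := \sum_(i < n) _ in qle0; set s2 := \sum_(i < n) _ in qle0.
have s1_ge0 i : 0 <= (x *m T) 0 i * (x *m T)^T i 0.
  by rewrite [X in _ * X]mxE -expr2 sqr_ge0.
have s2E : s2 = \sum_(i < n) 2 * ((i == 0%N :> nat)%:R
    + (i == n.-1 :> nat)%:R) * x 0 i ^+ 2.
  by apply: eq_bigr => i _; rewrite mul_mx_diag !mxE; ring.
have s2_ge0 (i : 'I_n) : 0 <= 2 * ((i == 0%N :> nat)%:R
    + (i == n.-1 :> nat)%:R) * x 0 i ^+ 2 :> R.
  by rewrite mulr_ge0 ?sqr_ge0 // mulr_ge0 // addr_ge0.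
have s10 : 0 <= s1 by apply: sumr_ge0.
have s20 : 0 <= s2 by rewrite s2E; apply: sumr_ge0.
have {}s10 : s1 = 0 by lra.
have {}s20 : s2 = 0 by lra.
have xT i : (x *m T) 0 i = 0.
  have /psumr_eq0P/(_ s10 i isT) := fun j (_ : true) => s1_ge0 j.
  by rewrite [X in _ * X]mxE => /eqP; rewrite mulf_eq0 orbb => /eqP.
have x0 : x 0 (Ordinal n_gt0) = 0.
  rewrite s2E in s20.
  have /psumr_eq0P/(_ s20 (Ordinal n_gt0) isT) := fun j (_ : true) => s2_ge0 j.
  move=> /= /eqP; rewrite mulf_eq0 sqrf_eq0 => /orP[|/eqP//].
  by rewrite -natrD -natrM pnatr_eq0; case: (_ == n.-1).
have rec (i : 'I_n) (h : (i.+1 < n)%N) : (forall k : 'I_n, (k <= i)%N -> x 0 k = 0)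
    -> x 0 (Ordinal h) = 0.
  move=> IH; have := xT i.
  rewrite -[x *m T]trmxK trmx_mul TT mxE /T /second_diff_mx !mulmxBl mul_scalar_mx.
  rewrite !mxE (bigD1 (Ordinal h)) //= !mxE eqxx mul1r IH // mulr0 sub0r.
  rewrite big1 => [|k nk]; last first.
    rewrite !mxE; case: eqP => [e|]; last by rewrite mul0r.
    by case/eqP: nk; apply: val_inj.
  rewrite big1 => [|k _]; last first.
    rewrite !mxE; case: eqP => [e|]; last by rewrite mul0r.
    by rewrite IH ?mulr0 // -e.
  by move=> /eqP; rewrite addr0 subr0 oppr_eq0 => /eqP.
apply/eqP/rowP => i; rewrite mxE.
case: i => m; elim/ltn_ind: m => -[|m] IH lm.
  by rewrite -[RHS]x0; congr (x _ _); apply: val_inj.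
apply: (rec (Ordinal (ltnW lm))) => -[k lk] /= km.
exact: IH.
Qed.

Lemma clamped_mx_unit (R : realType) n : (1 < n)%N -> clamped_mx R n \in unitmx.
Proof.
move=> n_gt1; rewrite -row_free_unit -kermx_eq0.
apply/rowV0P => x /sub_kermxP xA0; apply/eqP; apply: contraT => /clamped_mx_posdef.
by move=> /(_ n_gt1); rewrite xA0 mul0mx mxE ltxx.
Qed.

(* Main.v *)
Require Import Defs.
From mathcomp Require Import all_boot all_order all_algebra.
From mathcomp Require Import ring lra zify.
From mathcomp Require Import all_classical all_reals all_analysis.

Import Order.TTheory GRing.Theory Num.Theory.
Local Open Scope ring_scope.

(** Let T be the second-difference matrix, N = n + 1, and A the clamped-clamped
    matrix. Every entry of the inverse of A is at most N^3 / 32 in absolute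
    value ([norm_inv_clamped_mx_le]), and an n x n matrix with entries bounded
    by B has p-norm at most n B ([mx_pnorm_le_entries]); the theorem follows
    since n N^3 <= N^4.

    The entry bound is an energy argument. A differs from T^2 by a nonnegative
    diagonal matrix supported at the two corners, hence the bending energy
    |T u|^2 is at most the quadratic form <u, A u> ([bending_energy_le]).
    Conversely, the bending energy controls u pointwise: T has an explicit
    inverse G, the Green matrix of the discrete Dirichlet problem, and
    Cauchy-Schwarz applied to u = G (T u) gives
    u_i^2 <= (sum_j G_ij^2) |T u|^2 <= (N^3 / 32) |T u|^2
    ([sqr_le_bending_energy]). When u is the j-th column of the inverse of A,
    the form <u, A u> is the single coordinate u_j. So, with B = N^3 / 32,
    every coordinate satisfies u_i^2 <= B u_j; taking i = j gives u_j <= B, and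
    then u_i^2 <= B^2 for all i. *)

(** * Finite sums *)

Lemma sum_delta {R : pzSemiRingType} {n : nat} (a : nat) (f : nat -> R) :
  \sum_(k < n) (k == a :> nat)%:R * f k = if (a < n)%N then f a else 0.
Proof.
case: ifPn => [la|nla]; last first.
  rewrite big1 // => k _; case: eqP => [e|_]; last by rewrite mul0r.
  by rewrite -e ltn_ord in nla.
rewrite (bigD1 (Ordinal la)) //= eqxx mul1r big1 ?addr0 // => k nk.
have -> : (k == a :> nat) = false by apply: contra_neqF nk => /eqP e; apply: val_inj.
by rewrite mul0r.
Qed.

Lemma cauchy_schwarz {R : realFieldType} {I : finType} (a b : I -> R) :
  (\sum_i a i * b i) ^+ 2 <= (\sum_i a i ^+ 2) * (\sum_i b i ^+ 2).
Proof.
have expand (t c : R) : \sum_i (t * b i - c * a i) ^+ 2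
    = t ^+ 2 * (\sum_i b i ^+ 2) - 2 * t * c * (\sum_i a i * b i)
      + c ^+ 2 * (\sum_i a i ^+ 2).
  rewrite !mulr_sumr -sumrB -big_split /=.
  by apply: eq_bigr => i _; ring.
set s := \sum_i a i * b i; set A := \sum_i a i ^+ 2; set B := \sum_i b i ^+ 2.
have A_ge0 : 0 <= A by apply: sumr_ge0 => i _; exact: sqr_ge0.
have := A_ge0; rewrite le0r => /orP[/eqP A0|A_gt0].
  have a0 i : a i = 0.
    apply/eqP; rewrite -sqrf_eq0; apply/eqP.
    by apply: (psumr_eq0P _ A0) => // j _; exact: sqr_ge0.
  by rewrite /s big1 ?expr0n ?A0 ?mul0r // => i _; rewrite a0 mul0r.
(* Up to the factor A, A b - s a is the component of b orthogonal to a. *)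
have : 0 <= \sum_i (A * b i - s * a i) ^+ 2.
  by apply: sumr_ge0 => i _; exact: sqr_ge0.
rewrite expand -/A -/B -/s.
have -> : A ^+ 2 * B - 2 * A * s * s + s ^+ 2 * A = A * (A * B - s ^+ 2) by ring.
by rewrite pmulr_rge0 // subr_ge0.
Qed.

(** * The second-difference matrix and its Green matrix *)

(** Extending the grid function by zero to the two boundary points makes the
    first and last rows of T second differences like the others. *)
Lemma mul_second_diff_mxE {R : realType} {n m : nat} (w : nat -> 'I_m -> R) i j :
  (forall j, w 0%N j = 0) -> (forall j, w n.+1 j = 0) ->
  (second_diff_mx R n *m \matrix_(i < n, j < m) w i.+1 j) i j
  = 2 * w i.+1 j - w i j - w i.+2 j.
Proof.
move=> w0 wn; have li := ltn_ord i.
rewrite /second_diff_mx !mulmxBl mul_scalar_mx !mxE addrAC.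
congr (_ - _ - _).
  under eq_bigr do rewrite !mxE.
  case: (posnP i) => [i0|i_gt0].
    by rewrite i0 w0 big1 // => k _; rewrite mul0r.
  have pred_eq (k : nat) : (k.+1 == i) = (k == i.-1) by rewrite -[in RHS]eqSS prednK.
  under eq_bigr do rewrite pred_eq.
  by rewrite (sum_delta _ (fun k => w k.+1 j)) prednK // ifT //; lia.
under eq_bigr do rewrite !mxE eq_sym.
rewrite (sum_delta _ (fun k => w k.+1 j)).
by case: ltnP => // ?; have -> : i.+1 = n by lia.
Qed.

(** The Green function of the discrete Dirichlet problem on the points
    0, 1, ..., N: as a function of a, it is affine away from b, vanishes at
    both ends, and its slope drops by 1 at b. *)
Definition green_fun (R : realType) (N a b : nat) : R :=
  (minn a b)%:R * (N - maxn a b)%:R / N%:R.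

(** The shifts by one match 0-based matrix indices with the interior points
    1, ..., n of the grid 0, ..., n + 1. *)
Definition green_mx (R : realType) (n : nat) : 'M[R]_n :=
  \matrix_(i, j) green_fun R n.+1 i.+1 j.+1.

Lemma green_fun_left (R : realType) (N a b : nat) : (a <= b <= N)%N ->
  green_fun R N a b = a%:R * (N%:R - b%:R) / N%:R.
Proof.
move=> /andP[ab bN]; rewrite /green_fun (minn_idPl ab) (maxn_idPr ab).
by rewrite natrB.
Qed.

Lemma green_fun_right (R : realType) (N a b : nat) : (b <= a <= N)%N ->
  green_fun R N a b = b%:R * (N%:R - a%:R) / N%:R.
Proof. by move=> baN; rewrite /green_fun minnC maxnC; exact: green_fun_left. Qed.

Lemma mul_second_diff_green {R : realType} {n : nat} :
  second_diff_mx R n *m green_mx R n = 1%:M.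
Proof.
apply/matrixP => i j; have lj := ltn_ord j; have li := ltn_ord i.
have n0 : n.+1%:R != 0 :> R by rewrite pnatr_eq0.
rewrite (mul_second_diff_mxE (fun a (b : 'I_n) => green_fun R n.+1 a b.+1)).
- rewrite mxE -val_eqE /=.
  case: (ssrnat.ltngtP (i : nat) (j : nat)) => ij /=.
  + by rewrite !green_fun_left; try lia; ring.
  + by rewrite !green_fun_right; try lia; ring.
  (* On the diagonal the three points straddle the kink of the Green function. *)
  + rewrite -!ij (green_fun_right R n.+1 i.+2) ?green_fun_left; try lia.
    by rewrite mulr1n; field.
- by move=> k; rewrite /green_fun min0n !mul0r.
- move=> k; rewrite green_fun_right; last by have := ltn_ord k; lia.
  by rewrite subrr mulr0 mul0r.
Qed.

Lemma mul_green_second_diff {R : realType} {n : nat} :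
  green_mx R n *m second_diff_mx R n = 1%:M.
Proof. exact: mulmx1C mul_second_diff_green. Qed.

(** The row sums form G 1, where 1 is the all-ones vector; this is the
    solution of T q = 1, namely the parabola q(a) = a (N - a) / 2. *)
Lemma green_mx_row_sum {R : realType} {n : nat} (i : 'I_n) :
  \sum_j green_mx R n i j = i.+1%:R * (n - i)%:R / 2.
Proof.
pose q (a : nat) (_ : 'I_1) : R := a%:R * (n.+1%:R - a%:R) / 2.
have Tq : second_diff_mx R n *m \matrix_(i < n, j < 1) q i.+1 j = const_mx 1.
  apply/matrixP => k l; rewrite mul_second_diff_mxE => [|?|?].
  - by rewrite !mxE /q; field.
  - by rewrite /q !mul0r.
  - by rewrite /q subrr mulr0 mul0r.
have /matrixP/(_ i 0) : green_mx R n *m const_mx 1 = \matrix_(i < n, j < 1) q i.+1 j.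
  by rewrite -Tq mulmxA mul_green_second_diff mul1mx.
rewrite !mxE /q => e; rewrite -subSS natrB ?ltnS; last by have := ltn_ord i; lia.
by rewrite -e; apply: eq_bigr => j _; rewrite [X in _ * X]mxE mulr1.
Qed.

Lemma green_mx_ge0 {R : realType} {n : nat} (i j : 'I_n) : 0 <= green_mx R n i j.
Proof. by rewrite mxE /green_fun !mulr_ge0 ?invr_ge0. Qed.

Lemma mul4_le_sqr (a b N : nat) : (a + b <= N -> a * b * 4 <= N * N)%N.
Proof.
move=> abN; rewrite mulnC; apply: leq_trans (nat_AGM2 a b) _.
by rewrite mulnn leq_exp2r.
Qed.

Lemma green_mx_le {R : realType} {n : nat} (i j : 'I_n) :
  green_mx R n i j <= n.+1%:R / 4.
Proof.
rewrite mxE /green_fun ler_pdivrMr ?ltr0n //.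
have le : (minn i.+1 j.+1 * (n.+1 - maxn i.+1 j.+1) * 4 <= n.+1 * n.+1)%N.
  by apply: mul4_le_sqr; have := ltn_ord i; have := ltn_ord j; lia.
by move: le; rewrite -(ler_nat R) !natrM; lra.
Qed.

(** Bounding one factor of each square by the largest entry N / 4 leaves a row
    sum, itself at most N^2 / 8. *)
Lemma green_mx_sqr_sum_le {R : realType} {n : nat} (i : 'I_n) :
  \sum_j green_mx R n i j ^+ 2 <= n.+1%:R ^+ 3 / 32.
Proof.
have li := ltn_ord i.
apply: (@le_trans _ _ (n.+1%:R / 4 * \sum_j green_mx R n i j)).
  rewrite mulr_sumr; apply: ler_sum => j _.
  by rewrite expr2 ler_wpM2r ?green_mx_ge0 ?green_mx_le.
rewrite green_mx_row_sum.
have -> : n.+1%:R ^+ 3 / 32 = n.+1%:R / 4 * (n.+1%:R ^+ 2 / 8) :> R by field.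
apply: ler_wpM2l; first by rewrite divr_ge0.
have le : (i.+1 * (n - i) * 4 <= n.+1 * n.+1)%N.
  by apply: mul4_le_sqr; lia.
by move: le; rewrite -(ler_nat R) !natrM; lra.
Qed.

(** * Energy estimates *)

(** A discrete Sobolev inequality: Cauchy-Schwarz in u = G (T u). *)
Lemma sqr_le_bending_energy {R : realType} {n : nat} (u : 'cV[R]_n) (i : 'I_n) :
  u i 0 ^+ 2 <= n.+1%:R ^+ 3 / 32 * \sum_j (second_diff_mx R n *m u) j 0 ^+ 2.
Proof.
rewrite -{1}[u]mul1mx -mul_green_second_diff -mulmxA [X in X ^+ 2]mxE.
apply: le_trans (cauchy_schwarz _ _) _.
apply: ler_wpM2r; last exact: green_mx_sqr_sum_le.
by apply: sumr_ge0 => j _; exact: sqr_ge0.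
Qed.

(** The defect is the clamping term 2 u_1^2 + 2 u_n^2. *)
Lemma bending_energy_le {R : realType} {n : nat} (u : 'cV[R]_n) : (1 < n)%N ->
  \sum_j (second_diff_mx R n *m u) j 0 ^+ 2 <= (u^T *m (clamped_mx R n *m u)) 0 0.
Proof.
move=> n_gt1; rewrite clamped_mxE // mulmxDl mulmxDr.
set T := second_diff_mx R n.
have TT : T^T = T.
  by rewrite /T /second_diff_mx !raddfB /= tr_scalar_mx trmxK addrAC.
rewrite -[T *m T *m u]mulmxA [u^T *m (T *m _)]mulmxA -{2}TT -trmx_mul.
rewrite mxE; have -> : ((T *m u)^T *m (T *m u)) 0 0 = \sum_j (T *m u) j 0 ^+ 2.
  by rewrite mxE; apply: eq_bigr => j _; rewrite [X in X * _]mxE expr2.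
rewrite lerDl mxE; apply: sumr_ge0 => j _.
rewrite mul_diag_mx !mxE mulrCA -expr2.
by apply: mulr_ge0; rewrite ?sqr_ge0 ?mulr_ge0 ?addr_ge0.
Qed.

Lemma norm_inv_clamped_mx_le {R : realType} {n : nat} (i j : 'I_n) : (1 < n)%N ->
  `|invmx (clamped_mx R n) i j| <= n.+1%:R ^+ 3 / 32.
Proof.
move=> n_gt1; set B := _ / 32; set u := col j (invmx (clamped_mx R n)).
have B_gt0 : 0 < B by rewrite divr_gt0 ?exprn_gt0 ?ltr0n.
have uE k : u k 0 = invmx (clamped_mx R n) k j by rewrite mxE.
(* The form at u collapses to u_j because A u is the j-th basis vector. *)
have uAu : (u^T *m (clamped_mx R n *m u)) 0 0 = u j 0.
  rewrite {2}/u colE mulKVmx ?clamped_mx_unit //.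
  rewrite mxE (bigD1 j) //= !mxE !eqxx mulr1 big1 ?addr0 // => k /negPf kj.
  by rewrite !mxE kj mulr0.
have le k : u k 0 ^+ 2 <= B * u j 0.
  rewrite -uAu; apply: le_trans (sqr_le_bending_energy u k) _.
  by rewrite ler_wpM2l ?(ltW B_gt0) ?bending_energy_le.
have uj_ge0 : 0 <= u j 0.
  by rewrite -(pmulr_rge0 _ B_gt0); apply: le_trans (le j); exact: sqr_ge0.
have uj_le : u j 0 <= B by have := le j; nra.
rewrite -uE -(@ler_pXn2r _ 2) ?nnegrE ?(ltW B_gt0) // real_normK ?num_real //.
by apply: le_trans (le i) _; rewrite expr2 ler_wpM2l ?(ltW B_gt0).
Qed.

(** * From entries to operator norms *)

Lemma norm_mulmx_le {R : realType} {n : nat} (M : 'M[R]_n) (B : R) (x : 'cV[R]_n) i :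
  (forall i j, `|M i j| <= B) -> `|(M *m x) i 0| <= B * \sum_j `|x j 0|.
Proof.
move=> MB; rewrite mxE mulr_sumr; apply: le_trans (ler_norm_sum _ _ _) _.
by apply: ler_sum => j _; rewrite normrM ler_wpM2r.
Qed.

(** The entry bound gives |M x|_oo <= B |x|_1, and the comparisons
    |y|_p <= n^(1/p) |y|_oo and |x|_1 <= n^(1 - 1/p) |x|_p together cost a
    factor n, whatever p is. *)
Lemma mx_pnorm_le_entries {R : realType} {n : nat} (p : \bar R) (M : 'M[R]_n) (B : R) :
  p = 1%:E \/ p = 2%:E \/ p = +oo%E -> 0 <= B ->
  (forall i j, `|M i j| <= B) -> (mx_pnorm p M <= (n%:R * B)%:E)%E.
Proof.
move=> hp B_ge0 MB; apply: ge_ereal_sup => _ [x /= _ <-]; rewrite lee_fin.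
have nB_ge0 : 0 <= n%:R * B by rewrite mulr_ge0.
(* A quotient by a vanishing norm is 0, so nonnegativity of the norm suffices. *)
suff le : vec_pnorm p (M *m x) <= n%:R * B * vec_pnorm p x /\ 0 <= vec_pnorm p x.
  case: le => le; rewrite le0r => /orP[/eqP ->|x_gt0].
    by rewrite invr0 mulr0.
  by rewrite ler_pdivrMr.
have Mx i := norm_mulmx_le M B x i MB.
set s := \sum_j _ in Mx.
have s_ge0 : 0 <= s by apply: sumr_ge0.
have sum_const (c : R) : \sum_(i < n) c = n%:R * c.
  by rewrite sumr_const card_ord mulr_natl.
case: hp => [->|[->|->]] /=.
- have E (y : 'cV[R]_n) :
      (\sum_(i < n) `|y i 0| `^ 1) `^ 1^-1 = \sum_(i < n) `|y i 0|.
    under eq_bigr do rewrite powRr1 //.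
    by rewrite invr1 powRr1 // sumr_ge0.
  rewrite !E -/s; split=> //.
  by rewrite -mulrA -sum_const; apply: ler_sum => i _.
- have E (y : 'cV[R]_n) :
      (\sum_(i < n) `|y i 0| `^ 2) `^ 2^-1 = Num.sqrt (\sum_(i < n) `|y i 0| ^+ 2).
    under eq_bigr do rewrite powR_mulrn //.
    by rewrite powR12_sqrt // sumr_ge0.
  rewrite !E sqrtr_ge0; split=> //.
  have -> : n%:R * B = Num.sqrt ((n%:R * B) ^+ 2) by rewrite sqrtr_sqr ger0_norm.
  rewrite -sqrtrM ?sqr_ge0 //; apply: ler_wsqrtr.
  apply: (@le_trans _ _ (n%:R * (B * s) ^+ 2)).
    rewrite -sum_const; apply: ler_sum => i _.
    by rewrite lerXn2r // ?nnegrE ?mulr_ge0.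
  have cs : s ^+ 2 <= n%:R * \sum_(i < n) `|x i 0| ^+ 2.
    have := cauchy_schwarz (fun=> 1) (fun i : 'I_n => `|x i 0|).
    under eq_bigr do rewrite mul1r.
    by rewrite sum_const expr1n mulr1.
  set S := \sum_(i < n) _ in cs *.
  have -> : (n%:R * B) ^+ 2 * S = n%:R * (B ^+ 2 * (n%:R * S)) by ring.
  by rewrite exprMn ler_wpM2l // ler_wpM2l ?sqr_ge0.
- set m := \big[_/_]_(i < n) `|x i 0|.
  have m_ge0 : 0 <= m by exact: bigmax_ge_id.
  split=> //; apply: bigmax_le => [|i _]; first exact: mulr_ge0.
  apply: le_trans (Mx i) _; rewrite [n%:R * B]mulrC -mulrA ler_wpM2l //.
  by rewrite -sum_const; apply: ler_sum => j _; exact: le_bigmax.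
Qed.

Theorem theorem3p2 (R : realType) (n : nat) (hn : (5 <= n)%N)
  (p : \bar R) (hp : p = 1%:E \/ p = 2%:E \/ p = +oo%E) :
  (mx_pnorm p (invmx (clamped_mx R n)) <= ((n + 1)%:R ^+ 4 / 32)%:E)%E.
Proof.
have B_ge0 : 0 <= n.+1%:R ^+ 3 / 32 :> R by rewrite divr_ge0 ?exprn_ge0.
apply: le_trans (mx_pnorm_le_entries _ _ _ hp B_ge0 _) _.
  by move=> i j; apply: norm_inv_clamped_mx_le; lia.
by rewrite lee_fin addn1 [_ ^+ 4]exprS -mulrA ler_wpM2r // ler_nat.
Qed.
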